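(* Let $\mathcal{H}$ be a hypergraph with $n\ge 2$ vertices and let $\lambda_1$ be the largest eigenvalue of its adjacency matrix. Then $$\mathcal{E}(\mathcal{H})\ge\sqrt{\frac{2n}{n-1}\lambda_1^2}.$$ Equality holds if and only if $\mathcal{H}$ is the $2$-uniform hypergraph with two vertices and one edge, or $\mathcal{H}$ has no edges.
   Context: A hypergraph $\mathcal{H}=(V,E)$ consists of a finite vertex set $V$ and a set $E$ of edges, each edge being a subset of $V$ of cardinality at least $2$ (distinct edges are distinct subsets). For $i\neq j$, $d(\{i,j\})$ is the number of edges containing both $i$ and $j$. The adjacency matrix $\mathbf{A}(\mathcal{H})$ is the $n\times n$ matrix with zero diagonal and $(i,j)$ entry $d(\{i,j\})$ for $i\neq j$. The energy is $\mathcal{E}(\mathcal{H})=\sum_{i=1}^n|\lambda_i|$, where $\lambda_1\ge\dots\ge\lambda_n$ are the eigenvalues of $\mathbf{A}(\mathcal{H})$. *)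

(* Defs.v *)
From HB Require Import structures.
From mathcomp Require Import all_boot all_order all_algebra.
From mathcomp Require Import reals.
From mathcomp Require Import polyrcf complex.

Set Implicit Arguments.
Unset Strict Implicit.
Unset Printing Implicit Defensive.

Import Order.TTheory GRing.Theory Num.Theory.
Local Open Scope ring_scope.

Record hypergraph (V : finType) := Hypergraph {
  edges : {set {set V}};
  edges_card_ge2 : forall e : {set V}, e \in edges -> (2 <= #|e|)%N
}.

Definition uniform (V : finType) (k : nat) (H : hypergraph V) : Prop :=
  forall e : {set V}, e \in edges H -> #|e| = k.

Definition codegree (V : finType) (H : hypergraph V) (i j : V) : nat :=
  #|[set e in edges H | (i \in e) && (j \in e)]|.

(* Rows and columns are indexed through the enumeration of V. *)
Definition adjacency (R : realType) (V : finType) (H : hypergraph V) :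
    'M[R]_#|V| :=
  \matrix_(i, j)
    if i == j then 0 else (codegree H (enum_val i) (enum_val j))%:R.

(* Real roots of the characteristic polynomial, repeated according to their
   algebraic multiplicity, in nonincreasing order. [eigenvalues_sym] shows
   that for a symmetric matrix they are all the eigenvalues. *)
Definition eigenvalues (R : realType) (n : nat) (A : 'M[R]_n) : seq R :=
  sort >=%R
    (flatten [seq nseq (mup x (char_poly A)) x | x <- rootsR (char_poly A)]).

Definition largest_eigenvalue (R : realType) (V : finType)
    (H : hypergraph V) : R :=
  head 0 (eigenvalues (adjacency R H)).

Definition energy (R : realType) (V : finType) (H : hypergraph V) : R :=
  \sum_(x <- eigenvalues (adjacency R H)) `|x|.

Lemma char_poly_sym_split (R : realType) (n : nat) (A : 'M[R]_n) :
  A^T = A -> exists s : seq R, char_poly A = \prod_(x <- s) ('X - x%:P).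
Proof.
move=> symA; pose f := real_complex R.
have hA : map_mx f A \is hermsymmx.
  apply/is_hermitianmxP; rewrite expr0 scale1r; apply/matrixP => i j.
  by rewrite !mxE -{1}symA mxE /f /= conj_Creal // complex_real.
have dR := hermitian_spectral_diag_real hA.
have /orthomx_spectralP AE := hermitian_normalmx hA.
have Pu := spectral_unit (map_mx f A).
set P := spectralmx _ in AE Pu; set d := spectral_diag _ in AE dR.
have cE : map_poly f (char_poly A) = \prod_(i < n) ('X - (d 0 i)%:P).
  transitivity (char_poly (diag_mx d)); last first.
    rewrite char_poly_trig ?diag_mx_is_trig //.
    by apply: eq_bigr => i _; rewrite mxE eqxx mulr1n.
  rewrite map_char_poly AE /char_poly /char_poly_mx.
  have iP : map_mx polyC (invmx P) *m map_mx polyC P = 1%:M.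
    by rewrite -[LHS](map_mxM polyC) mulVmx // [LHS](map_mx1 polyC).
  have -> : 'X%:M - map_mx polyC (invmx P *m diag_mx d *m P) =
      map_mx polyC (invmx P) *m ('X%:M - map_mx polyC (diag_mx d)) *m
      map_mx polyC P.
    rewrite !map_mxM mulmxBr mulmxBl scalar_mxC -[_%:M *m _ *m _]mulmxA.
    by rewrite iP mulmx1.
  rewrite !det_mulmx mulrAC -det_mulmx iP.
  by rewrite det1 mul1r.
exists [seq complex.Re (d 0 i) | i <- enum 'I_n].
apply: (map_poly_inj f); rewrite {}cE big_map rmorph_prod /= big_enum /=.
apply: eq_bigr => i _; rewrite rmorphB /= map_polyX map_polyC /=.
by rewrite /f RRe_real // (mxOverP dR).
Qed.

Lemma eigenvalues_sym (R : realType) (n : nat) (A : 'M[R]_n) :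
  A^T = A ->
  char_poly A = \prod_(x <- eigenvalues A) ('X - x%:P).
Proof.
case/char_poly_sym_split => s Es; rewrite Es.
apply: perm_big; rewrite /eigenvalues perm_sym perm_sort.
have p0 : char_poly A != 0 by rewrite monic_neq0 // char_poly_monic.
apply/allP => x _ /=; rewrite count_flatten -map_comp sumnE big_map /=.
under eq_bigr do rewrite /= count_nseq /=.
have ur : uniq (rootsR (char_poly A)) by exact: uniq_roots.
have mE y : mup y (char_poly A) = count_mem y s.
  by rewrite Es; exact: mu_prod_XsubC.
have [xr|xr] := boolP (x \in rootsR (char_poly A)).
  rewrite (bigD1_seq x) //= eqxx mul1n mE big1 ?addn0 // => y.
  by move=> /negPf->; rewrite mul0n.
rewrite big1_seq => [|y /= yr]; last first.
  by case: eqP => [yx|_]; [rewrite -yx yr in xr | rewrite mul0n].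
rewrite -mE mupNroot //; apply: contra xr => rx.
by rewrite -roots_on_rootsR // in_itv.
Qed.

Lemma adjacency_sym (R : realType) (V : finType) (H : hypergraph V) :
  (adjacency R H)^T = adjacency R H.
Proof.
apply/matrixP => i j; rewrite !mxE eq_sym; case: eqP => // _.
by congr (_%:R); apply: eq_card => e; rewrite !inE [X in _ && X]andbC.
Qed.

(* Main.v *)
Require Import Defs.
From mathcomp Require Import all_boot all_order all_algebra.
From mathcomp Require Import reals.
From mathcomp Require Import ring.

Import Order.TTheory GRing.Theory Num.Theory.
Local Open Scope ring_scope.

(** The trace is zero, so the eigenvalues other than [lambda_1] sum to
    [- lambda_1] and the energy is at least [2 |lambda_1|]. Since
    [2n/(n-1) <= 4], strictly for [n > 2], this gives the bound; for [n > 2]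
    equality forces [lambda_1 = 0], hence zero energy, hence (a nilpotent real
    symmetric matrix being zero) no edges. For [n = 2] the only possible edge is
    the whole vertex set and equality always holds. *)

Lemma size_eigenvalues (R : realType) (n : nat) (A : 'M[R]_n) :
  A^T = A -> size (eigenvalues A) = n.
Proof.
move=> symA; apply/eqP; rewrite -eqSS -(size_prod_XsubC _ id) /=.
by rewrite -eigenvalues_sym // size_char_poly.
Qed.

(** Up to sign, both sides are the coefficient of degree [n - 1] of the characteristic polynomial.
    The case [n = 0] is apart, as there is no such coefficient. *)
Lemma sum_eigenvalues (R : realType) (n : nat) (A : 'M[R]_n) :
  A^T = A -> \sum_(x <- eigenvalues A) x = \tr A.
Proof.
case: n A => [A _|n A symA].
  rewrite [eigenvalues A]size0nil ?big_nil; last first.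
    by apply: size_eigenvalues; apply/matrixP => -[].
  by rewrite /mxtrace big_ord0.
apply: oppr_inj; rewrite -char_poly_trace // eigenvalues_sym //.
have := @coefPn_prod_XsubC _ (eigenvalues A).
by rewrite size_eigenvalues // => ->.
Qed.

(** By symmetry, the [i]-th diagonal entry of [A *m A] is the sum of the squares of row [i]. *)
Lemma sym_sqr_eq0 (R : realDomainType) (n : nat) (A : 'M[R]_n) :
  A^T = A -> A *m A = 0 -> A = 0.
Proof.
move=> symA A20; apply/matrixP => i j; rewrite mxE; apply/eqP.
have /eqP := congr1 (fun B : 'M_n => B i i) A20; rewrite !mxE.
have sqE k : A i k * A k i = A i k ^+ 2 by rewrite -{2}symA mxE expr2.
under eq_bigr do rewrite sqE.
rewrite psumr_eq0 => [/allP/(_ j)|k _]; last exact: sqr_ge0.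
by rewrite mem_index_enum sqrf_eq0 => /(_ isT).
Qed.

(** The exponent is raised to a power of two, then halved repeatedly: each [A ^+ (2 ^ k)] is
    symmetric, so it vanishes once its square does. *)
Lemma sym_nilpotent_eq0 (R : realDomainType) (n k : nat) (A : 'M[R]_n.+1) :
  A^T = A -> A ^+ k = 0 -> A = 0.
Proof.
move=> symA Ak0.
have: A ^+ (2 ^ k) = 0.
  by rewrite -(subnK (ltnW (ltn_expl k (isT : 1 < 2)%N))) exprD Ak0 mulr0.
elim: {Ak0}k => [|k IHk]; first by rewrite expr1.
rewrite expnSr exprM expr2 => Ak0; apply: IHk; apply: sym_sqr_eq0 => //.
elim: (2 ^ k)%N => [|m IHm]; first by rewrite expr0 trmx1.
by rewrite exprS [LHS]trmx_mul IHm symA -[LHS]exprSr exprS.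
Qed.

(** If every eigenvalue is zero, the characteristic polynomial is a power of ['X], and
    Cayley-Hamilton makes [A] nilpotent. *)
Lemma sum_norm_eigenvalues_eq0 (R : realType) (n : nat) (A : 'M[R]_n) :
  A^T = A -> (\sum_(x <- eigenvalues A) `|x| == 0) = (A == 0).
Proof.
case: n A => [|n] A symA.
  rewrite [eigenvalues A]size0nil ?size_eigenvalues // big_nil eqxx.
  by apply/esym/eqP/matrixP => -[].
apply/idP/eqP => [|A0].
  rewrite psumr_eq0 // => /allP s0.
  have pE : char_poly A = 'X^(n.+1).
    rewrite eigenvalues_sym // (eq_big_seq (fun=> 'X)) => [|x /s0 /=].
      by rewrite big_const_seq count_predT size_eigenvalues // -Monoid.iteropE.
    by rewrite normr_eq0 => /eqP->; rewrite subr0.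
  have := Cayley_Hamilton A; rewrite pE rmorphXn /= horner_mx_X.
  exact: sym_nilpotent_eq0.
rewrite psumr_eq0 //; apply/allP => x xs /=; rewrite normr_eq0.
have: root (char_poly A) x by rewrite eigenvalues_sym // root_prod_XsubC.
rewrite A0 /char_poly /char_poly_mx map_mx0 subr0 det_scalar.
by rewrite rootE hornerXn expf_eq0.
Qed.

(** The tail sums to minus the head, so the triangle inequality bounds the norm of the head by the
    sum of norms over the tail. *)
Lemma head_norm_le_sum (R : realDomainType) (s : seq R) :
  \sum_(x <- s) x = 0 -> 2 * `|head 0 s| <= \sum_(x <- s) `|x|.
Proof.
case: s => [|x s] /=; first by rewrite !big_nil normr0 mulr0.
rewrite !big_cons mulr_natl mulr2n lerD2l => /eqP.
by rewrite addr_eq0 => /eqP->; rewrite normrN; apply: ler_norm_sum.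
Qed.

Lemma adjacency_tr0 (R : realType) (V : finType) (H : hypergraph V) :
  \tr (adjacency R H) = 0.
Proof. by rewrite /mxtrace big1 // => i _; rewrite mxE eqxx. Qed.

(** An edge contains two distinct vertices, and their entry counts that edge. *)
Lemma adjacency_eq0 (R : realType) (V : finType) (H : hypergraph V) :
  (adjacency R H == 0) = (edges H == set0).
Proof.
apply/eqP/eqP => [A0|E0]; last first.
  apply/matrixP => i j; rewrite !mxE; case: eqP => // _; rewrite /codegree.
  by rewrite E0 (eq_card0 (A := _)) // => e; rewrite !inE.
apply/setP => e; rewrite inE; apply/negP => eH.
have /card_gt1P[i [j [ie je ij]]] := edges_card_ge2 eH.
have := congr1 (fun B : 'M_#|V| => B (enum_rank i) (enum_rank j)) A0.
rewrite /adjacency !mxE (inj_eq enum_rank_inj) (negPf ij) !enum_rankK.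
move/eqP; rewrite pnatr_eq0 cards_eq0 => /eqP/setP/(_ e).
by rewrite !inE eH ie je.
Qed.

Lemma energy_eq0 (R : realType) (V : finType) (H : hypergraph V) :
  (energy R H == 0) = (edges H == set0).
Proof.
by rewrite /energy sum_norm_eigenvalues_eq0 ?adjacency_eq0 ?adjacency_sym.
Qed.

Lemma energy_ge_largest (R : realType) (V : finType) (H : hypergraph V) :
  2 * `|largest_eigenvalue R H| <= energy R H.
Proof.
apply: head_norm_le_sum.
by rewrite sum_eigenvalues ?adjacency_tr0 ?adjacency_sym.
Qed.

Lemma energy_card2 (R : realType) (V : finType) (H : hypergraph V) :
  #|V| = 2%N -> energy R H = 2 * `|largest_eigenvalue R H|.
Proof.
move=> n2; rewrite /energy /largest_eigenvalue.
have symA := adjacency_sym R H.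
have := sum_eigenvalues _ _ _ symA; rewrite adjacency_tr0.
have := etrans (size_eigenvalues _ _ _ symA) n2.
case: (eigenvalues _) => [|x [|y []]] //= _.
rewrite !big_cons !big_nil !addr0 => /eqP; rewrite addr_eq0 => /eqP->.
by rewrite normrN mulr_natl.
Qed.

Lemma card2_edges (V : finType) (H : hypergraph V) :
  #|V| = 2%N -> edges H = set0 \/ uniform 2 H /\ #|edges H| = 1%N.
Proof.
move=> n2.
have eT e : e \in edges H -> e = setT.
  move=> eH; apply/eqP; rewrite eqEcard subsetT cardsT n2.
  exact: edges_card_ge2 eH.
have: edges H \subset [set setT] by apply/subsetP => e /eT->; rewrite inE.
rewrite subset1 => /orP[/eqP EH|/eqP]; [right|by left].
by rewrite EH cards1; split=> // e /eT->; rewrite cardsT.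
Qed.

Theorem theorem28 (R : realType) (V : finType) (H : hypergraph V)
    (n := #|V|) (lambda1 := largest_eigenvalue R H) :
  (2 <= n)%N ->
  energy R H >= Num.sqrt (2 * n%:R / (n%:R - 1) * lambda1 ^+ 2) /\
  (energy R H = Num.sqrt (2 * n%:R / (n%:R - 1) * lambda1 ^+ 2) <->
   (uniform 2 H /\ n = 2%N /\ #|edges H| = 1%N) \/ edges H = set0).
Proof.
move=> n2; set c := 2 * n%:R / (n%:R - 1).
have n1 : 0 < n%:R - 1 :> R by rewrite subr_gt0 ltr1n.
have c0 : 0 <= c by rewrite divr_ge0 ?mulr_ge0 ?ler0n ?(ltW n1).
(* This form shows the sign: nonnegative for [n >= 2], positive for [n > 2]. *)
have c4 : 4 - c = 2 * (n%:R - 2) / (n%:R - 1).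
  by rewrite /c; field; rewrite gt_eqF.
have sqrt4 : Num.sqrt 4 = 2 :> R.
  by rewrite -[4](_ : 2 ^+ 2 = _) ?sqrtr_sqr ?ger0_norm // -natrX.
have le_c4 : c <= 4.
  by rewrite -subr_ge0 c4 divr_ge0 ?mulr_ge0 ?(ltW n1) // subr_ge0 ler_nat.
rewrite sqrtrM // sqrtr_sqr.
have E2 : 2 * `|lambda1| <= energy R H := energy_ge_largest R V H.
have cE : Num.sqrt c * `|lambda1| <= energy R H.
  by apply: le_trans E2; rewrite ler_wpM2r // -sqrt4 ler_wsqrtr.
split=> //; have [n_eq2|n_neq2] := eqVneq n 2%N.
  (* With two vertices, both sides of the equivalence hold outright. *)
  split=> _; first by have [?|[? ?]] := card2_edges V H n_eq2; [right|left].
  have -> : c = 4.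
    by apply/eqP; rewrite eq_sym -subr_eq0 c4 n_eq2 subrr mulr0 mul0r.
  by rewrite sqrt4 energy_card2.
have lt_c4 : Num.sqrt c < 2.
  rewrite -sqrt4 ltr_sqrt // -subr_gt0 c4 divr_gt0 ?mulr_gt0 //.
  by rewrite subr_gt0 ltr_nat ltn_neqAle eq_sym n_neq2.
split=> [eqE|[[_ [n_eq2 _]]|E0]]; last 2 first.
- by rewrite n_eq2 in n_neq2.
(* Without edges the energy is zero, and the nonnegative bound below it is zero too. *)
- have /eqP E_eq0 : energy R H == 0 by rewrite energy_eq0 E0.
  by apply/eqP; rewrite eq_le cE E_eq0 mulr_ge0 ?sqrtr_ge0.
right; apply/eqP; rewrite -(energy_eq0 R) eqE mulf_eq0 normr_eq0.
(* A nonzero [lambda1] would make the energy, equal to [Num.sqrt c] times its norm, smaller than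
   twice that norm, against [E2]. *)
apply/orP; right; apply: contraTT E2 => l0.
by rewrite -ltNge eqE ltr_pM2r ?normr_gt0.
Qed.
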